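(* Let $(R,\mathfrak{m})$ be a commutative noetherian local ring, $M$ a separated $R$-module, $M\subset N$ a pure-injective hull of $M$, and let $N_1$ be the submodule of $N$ containing $M$ with $N_1/M=P(N/M)$. Then $N_1$ is cotorsion and $$\hat M\cong N_1/H(N_1).$$
   Context: For an $R$-module $A$ put $H(A)=\bigcap_{n\ge1}\mathfrak{m}^nA$; $A$ is separated if $H(A)=0$ and radical-full if $\mathfrak{m}A=A$; $P(A)$ is the largest radical-full submodule of $A$. $A$ is cotorsion if $\operatorname{Ext}^1_R(C,A)=0$ for all flat $R$-modules $C$. $\hat M=\varprojlim M/\mathfrak{m}^nM$. A pure submodule $A\subset B$ is pure-essential in $B$ if every submodule $X\subset B$ with $X\cap A=0$ and $(X\oplus A)/X$ pure in $B/X$ is zero. A pure-injective hull of $M$ is a pure-essential extension $M\subset N$ with $N$ pure-injective. *)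

(* Defs.v *)
From HB Require Import structures.
From mathcomp Require Import all_boot all_algebra.
From mathcomp Require Import boolp classical_sets.
From mathcomp Require Import freeg.

Set Implicit Arguments.
Unset Strict Implicit.
Unset Printing Implicit Defensive.

Import GRing.Theory.
Local Open Scope ring_scope.

(* A submodule of M is a term of type [submodClosed M]; an ideal of R is a    *)
(* submodule of the regular module R^o. Membership is boolean, so submodules  *)
(* defined by a proposition go through classical logic.                       *)

Section Submodules.
Context {R : comNzRingType}.
Implicit Types M N : lmodType R.

Definition submod_prop M (P : M -> Prop) : Prop :=
  [/\ P 0, forall x y, P x -> P y -> P (x + y) & forall a x, P x -> P (a *: x)].

Lemma submod_prop_closed M (P : M -> Prop) :
  submod_prop P -> GRing.subsemimod_closed (fun x => `[< P x >]).
Proof.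
case=> P0 PD PZ; split; first split.
- exact/asboolP.
- by move=> x y /asboolP Px /asboolP Py; apply/asboolP/PD.
- by move=> a x /asboolP Px; apply/asboolP/PZ.
Qed.

Definition submod_of M (P : M -> Prop) (hP : submod_prop P) : submodClosed M :=
  HB.pack (fun x => `[< P x >])
    (GRing.isSubmodClosed.Build R M _ (submod_prop_closed hP)).

Lemma submod_ofP M (P : M -> Prop) (hP : submod_prop P) x :
  (x \in submod_of hP) <-> P x.
Proof. by split=> /asboolP. Qed.

Lemma submodN M (S : submodClosed M) x : x \in S -> - x \in S.
Proof. by move=> xS; rewrite -scaleN1r rpredZ. Qed.

Lemma submodB M (S : submodClosed M) x y : x \in S -> y \in S -> x - y \in S.
Proof. by move=> xS yS; rewrite rpredD// submodN. Qed.

Lemma fullm_prop M : submod_prop (fun _ : M => True).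
Proof. by []. Qed.

Definition fullm M : submodClosed M := submod_of (fullm_prop M).

Lemma spanm_prop M (G : M -> Prop) : submod_prop (fun x : M =>
  forall S : submodClosed M, (forall y, G y -> y \in S) -> x \in S).
Proof.
split=> [S _|x y hx hy S hS|a x hx S hS]; first exact: rpred0.
- by rewrite rpredD ?hx ?hy.
- by rewrite rpredZ ?hx.
Qed.

Definition spanm M (G : M -> Prop) : submodClosed M :=
  submod_of (spanm_prop G).

Lemma spanm_sub M (G : M -> Prop) x : G x -> x \in spanm G.
Proof. by move=> Gx; apply/submod_ofP => S; exact. Qed.

Lemma spanm_min M (G : M -> Prop) (S : submodClosed M) :
  (forall y, G y -> y \in S) -> {subset spanm G <= S}.
Proof. by move=> GS x /submod_ofP; exact. Qed.

Lemma addm_prop M (S T : submodClosed M) : submod_prop (fun z =>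
  exists x y, [/\ x \in S, y \in T & z = x + y]).
Proof.
split=> [|_ _ [x [y [xS yT ->]]] [x' [y' [xS' yT' ->]]]|a _ [x [y [xS yT ->]]]].
- by exists 0, 0; rewrite !rpred0 addr0.
- by exists (x + x'), (y + y'); rewrite !rpredD// addrACA.
- by exists (a *: x), (a *: y); rewrite !rpredZ// scalerDr.
Qed.

Definition addm M (S T : submodClosed M) : submodClosed M :=
  submod_of (addm_prop S T).

Lemma imagem_prop M N (f : {linear M -> N}) (S : submodClosed M) :
  submod_prop (fun y => exists2 x, x \in S & y = f x).
Proof.
split=> [|_ _ [x xS ->] [x' xS' ->]|a _ [x xS ->]].
- by exists 0; rewrite ?rpred0 ?linear0.
- by exists (x + x'); rewrite ?rpredD ?linearD.
- by exists (a *: x); rewrite ?rpredZ ?linearZ.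
Qed.

Definition imagem M N (f : {linear M -> N}) (S : submodClosed M) :
  submodClosed N := submod_of (imagem_prop f S).

(* The product I S of an ideal and a submodule; for M = R^o it is the product *)
(* of ideals.                                                                 *)
Definition smulm M (I : submodClosed R^o) (S : submodClosed M) :
  submodClosed M := spanm (fun z : M =>
    exists (a : R) (x : M), [/\ (a : R^o) \in I, x \in S & z = a *: x]).

End Submodules.

Section SubmoduleType.
Context {R : comNzRingType} (M : lmodType R) (S : submodClosed M).

Definition subm := {x : M | x \in S}.

HB.instance Definition _ := SubChoice.on subm.
HB.instance Definition _ := [SubChoice_isSubLmodule of subm by <:].

Definition subm_incl : {linear subm -> M} := \val.

End SubmoduleType.

Section QuotientModule.
Context {R : comNzRingType} {M : lmodType R} (S : submodClosed M).

(* [submodClosed] does not extend the [zmodClosed] expected by the library's *)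
(* quotient of abelian groups.                                               *)
Definition zmod_of_submod : zmodClosed M :=
  HB.pack (S : {pred M}) (GRing.isZmodClosed.Build M _
    (conj (rpred0 S) (fun x y => @submodB R M S x y))).

Definition quotm := ring_quotient.Quotient.quot zmod_of_submod.

HB.instance Definition _ := GRing.Zmodule.on quotm.

Definition quotm_proj (x : M) : quotm := (\pi_quotm x)%qT.
Definition quotm_repr (x : quotm) : M := repr x.

Lemma quotm_reprK : cancel quotm_repr quotm_proj.
Proof. exact: reprK. Qed.

Lemma quotm_projB : {morph quotm_proj : x y / x - y}.
Proof. exact: raddfB. Qed.

Lemma quotm_projD : {morph quotm_proj : x y / x + y}.
Proof. exact: raddfD. Qed.

Lemma quotm_proj_eq x y : quotm_proj x = quotm_proj y <-> x - y \in S.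
Proof.
have h := ring_quotient.Quotient.idealrBE zmod_of_submod x y.
by split=> [/eqP|xyS]; [rewrite -h | apply/eqP; rewrite -h].
Qed.

Lemma quotm_repr_proj x : quotm_repr (quotm_proj x) - x \in S.
Proof. by apply/quotm_proj_eq; rewrite quotm_reprK. Qed.

Definition quotm_scale (a : R) (x : quotm) : quotm :=
  quotm_proj (a *: quotm_repr x).

Lemma quotm_scale_proj a x : quotm_scale a (quotm_proj x) = quotm_proj (a *: x).
Proof.
by apply/quotm_proj_eq; rewrite -scalerBr rpredZ ?quotm_repr_proj.
Qed.

Let scaleA a b x : quotm_scale a (quotm_scale b x) = quotm_scale (a * b) x.
Proof.
by rewrite -[x]quotm_reprK !quotm_scale_proj scalerA.
Qed.
Let scale1 : left_id 1 quotm_scale.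
Proof. by move=> x; rewrite -[x]quotm_reprK !quotm_scale_proj scale1r. Qed.
Let scaleDr : right_distributive quotm_scale +%R.
Proof.
move=> a x y; rewrite -[x]quotm_reprK -[y]quotm_reprK -quotm_projD.
by rewrite !quotm_scale_proj scalerDr quotm_projD.
Qed.
Let scaleDl x : {morph quotm_scale^~ x : a b / a + b}.
Proof.
move=> a b; rewrite -[x]quotm_reprK !quotm_scale_proj.
by rewrite scalerDl quotm_projD.
Qed.

HB.instance Definition _ :=
  GRing.Zmodule_isLmodule.Build R quotm scaleA scale1 scaleDr scaleDl.

Lemma quotm_proj_linear : linear quotm_proj.
Proof. by move=> a x y; rewrite quotm_projD -quotm_scale_proj. Qed.

HB.instance Definition _ :=
  GRing.isLinear.Build R M quotm _ quotm_proj quotm_proj_linear.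

Lemma quotm_projP x : (quotm_proj x == 0) = (x \in S).
Proof.
rewrite -(linear0 quotm_proj).
by apply/eqP/idP => [/quotm_proj_eq|xS]; [|apply/quotm_proj_eq]; rewrite subr0.
Qed.

Section Lift.
Context {N : lmodType R} (f : {linear M -> N}).
Hypothesis fS : forall x, x \in S -> f x = 0.

Definition quotm_lift_fun (x : quotm) : N := f (quotm_repr x).

Lemma quotm_lift_proj x : quotm_lift_fun (quotm_proj x) = f x.
Proof.
by apply/eqP; rewrite -subr_eq0 -linearB fS ?quotm_repr_proj.
Qed.

Lemma quotm_lift_linear : linear quotm_lift_fun.
Proof.
move=> a x y; rewrite -[x]quotm_reprK -[y]quotm_reprK -linearP.
by rewrite !quotm_lift_proj linearP.
Qed.

Definition quotm_lift : {linear quotm -> N} :=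
  HB.pack quotm_lift_fun (GRing.isLinear.Build R quotm N _ _ quotm_lift_linear).

End Lift.
End QuotientModule.
Arguments quotm {R M} S.
Arguments quotm_proj {R M} S x.

Section TensorProduct.
Context {R : comNzRingType}.

Section FreeModule.
Context {K : choiceType} {M : lmodType R} (f : K -> M).

Lemma fglift_linear : linear (fglift f : {freeg K / R} -> M).
Proof.
pose fB := @lift_is_additive R K M f.
pose g : {additive {freeg K / R} -> M} :=
  HB.pack (fglift f) (GRing.isZmodMorphism.Build _ _ _ fB).
have gZ a x : g (a *: x) = a *: g x.
  rewrite [a *: x]/(fgscale a x) -[in RHS](freeg_sumE x).
  rewrite !(raddf_sum g) scaler_sumr; apply: eq_bigr => k _.
  by rewrite /= !liftU scalerA.
by move=> a x y; rewrite -[fglift f]/(g : _ -> _) raddfD gZ.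
Qed.

Definition freem_lift : {linear {freeg K / R} -> M} :=
  HB.pack (fglift f) (GRing.isLinear.Build R _ M _ _ fglift_linear).

Lemma freem_liftU k : freem_lift << k >> = f k.
Proof. by rewrite /= liftU scale1r. Qed.

End FreeModule.

Section Tensor.
Variables A B : lmodType R.

Local Notation gen a b := (<< (a, b) >> : {freeg (A * B)%type / R}).

Variant tens_rel : {freeg (A * B)%type / R} -> Prop :=
| TensDl a a' b : tens_rel (gen (a + a') b - (gen a b + gen a' b))
| TensDr a b b' : tens_rel (gen a (b + b') - (gen a b + gen a b'))
| TensZl r a b : tens_rel (gen (r *: a) b - r *: gen a b)
| TensZr r a b : tens_rel (gen a (r *: b) - r *: gen a b).

Definition tens := quotm (spanm tens_rel).

HB.instance Definition _ := GRing.Lmodule.on tens.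

Definition tensor (a : A) (b : B) : tens := quotm_proj (spanm tens_rel) (gen a b).

Lemma tens_relP x y : tens_rel (x - y) ->
  quotm_proj (spanm tens_rel) x = quotm_proj (spanm tens_rel) y.
Proof. by move=> /spanm_sub h; apply/quotm_proj_eq. Qed.

Lemma tensorDl a a' b : tensor (a + a') b = tensor a b + tensor a' b.
Proof. by rewrite /tensor (tens_relP (TensDl a a' b)) linearD. Qed.

Lemma tensorDr a b b' : tensor a (b + b') = tensor a b + tensor a b'.
Proof. by rewrite /tensor (tens_relP (TensDr a b b')) linearD. Qed.

Lemma tensorZl r a b : tensor (r *: a) b = r *: tensor a b.
Proof. by rewrite /tensor (tens_relP (TensZl r a b)) linearZ. Qed.

Lemma tensorZr r a b : tensor a (r *: b) = r *: tensor a b.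
Proof. by rewrite /tensor (tens_relP (TensZr r a b)) linearZ. Qed.

End Tensor.

Section TensorMap.
Context {A A' B B' : lmodType R} (f : {linear A -> A'}) (g : {linear B -> B'}).

Let pre : {linear {freeg (A * B)%type / R} -> tens A' B'} :=
  freem_lift (fun p => tensor (f p.1) (g p.2)).

Lemma tens_map_subproof x : x \in spanm (@tens_rel A B) -> pre x = 0.
Proof.
have ker_prop : submod_prop (fun x => pre x = 0).
  split=> [|x1 x2 h1 h2|a x1 h1]; first exact: linear0.
    by rewrite linearD h1 h2 addr0.
  by rewrite linearZ_LR h1 scaler0.
move=> /(spanm_min (S := submod_of ker_prop)) xK.
apply/(submod_ofP ker_prop)/xK => _ [] *; apply/submod_ofP; apply/eqP;
  rewrite linearB subr_eq0 ?[pre (_ + _)]linearD ?[pre (_ *: _)]linearZ_LR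
    !freem_liftU /=.
- by rewrite linearD tensorDl.
- by rewrite linearD tensorDr.
- by rewrite linearZ tensorZl.
- by rewrite linearZ tensorZr.
Qed.

Definition tens_map : {linear tens A B -> tens A' B'} :=
  quotm_lift tens_map_subproof.

Lemma tens_mapE a b : tens_map (tensor a b) = tensor (f a) (g b).
Proof.
rewrite [tensor a b]/(quotm_proj _ _).
rewrite [LHS](quotm_lift_proj tens_map_subproof).
exact: freem_liftU.
Qed.

End TensorMap.
End TensorProduct.

Section Homological.
Context {R : comNzRingType}.

Definition flat (C : lmodType R) : Prop :=
  forall (A B : lmodType R) (f : {linear A -> B}),
    injective f -> injective (tens_map f (idfun : {linear C -> C})).

Definition pure (B : lmodType R) (A : submodClosed B) : Prop :=
  forall X : lmodType R,
    injective (tens_map (idfun : {linear X -> X}) (subm_incl A)).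

Definition pure_injective (N : lmodType R) : Prop :=
  forall (B : lmodType R) (A : submodClosed B), pure A ->
  forall g : {linear subm A -> N},
  exists h : {linear B -> N}, forall x : subm A, h (\val x) = g x.

Definition pure_essential (B : lmodType R) (A : submodClosed B) : Prop :=
  pure A /\
  forall X : submodClosed B,
    (forall x, x \in X -> x \in A -> x = 0) ->
    pure (imagem (quotm_proj X) (addm X A)) ->
    forall x, x \in X -> x = 0.

Definition pure_injective_hull (N : lmodType R) (M : submodClosed N) : Prop :=
  pure_essential M /\ pure_injective N.

Definition surjm (A B : lmodType R) (f : {linear A -> B}) : Prop :=
  forall y, exists x, f x = y.

Definition exactm (A B C : lmodType R) (f : {linear A -> B})
    (g : {linear B -> C}) : Prop :=
  forall y, g y = 0 <-> exists x, f x = y.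

Definition projective (P : lmodType R) : Prop :=
  forall (A B : lmodType R) (g : {linear A -> B}) (f : {linear P -> B}),
    surjm g -> exists h : {linear P -> A}, forall x, g (h x) = f x.

(* The part of a projective resolution that computes Ext^1.                  *)
Definition resolution (P2 P1 P0 C : lmodType R) (d2 : {linear P2 -> P1})
    (d1 : {linear P1 -> P0}) (e : {linear P0 -> C}) : Prop :=
  [/\ projective P2, projective P1 & projective P0] /\
  [/\ exactm d2 d1, exactm d1 e & surjm e].

(* Ext^1(C, A) = 0: the complex Hom(P0, A) -> Hom(P1, A) -> Hom(P2, A) is    *)
(* exact in the middle for every projective resolution P of C; resolutions   *)
(* exist by [resolution_ex].                                                 *)
Definition ext1_eq0 (C A : lmodType R) : Prop :=
  forall (P2 P1 P0 : lmodType R) (d2 : {linear P2 -> P1})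
    (d1 : {linear P1 -> P0}) (e : {linear P0 -> C}), resolution d2 d1 e ->
  forall f : {linear P1 -> A}, (forall x, f (d2 x) = 0) ->
  exists g : {linear P0 -> A}, forall x, f x = g (d1 x).

Definition cotorsion (A : lmodType R) : Prop :=
  forall C : lmodType R, flat C -> ext1_eq0 C A.

Lemma freem_lift_uniq (K : choiceType) (M : lmodType R)
  (f g : {linear {freeg K / R} -> M}) :
  (forall k, f << k >> = g << k >>) -> f =1 g.
Proof.
move=> fg x; rewrite -(freeg_sumE x) !linear_sum; apply: eq_bigr => k _.
suff -> : << coeff k x *g k >> = coeff k x *: << k >> :> {freeg K / R}.
  by rewrite !linearZ_LR fg.
by apply/eqP/freeg_eqP => y; rewrite coeffZ !coeffU mul1r.
Qed.

Lemma free_projective (K : choiceType) : projective {freeg K / R}.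
Proof.
move=> A B g f g_surj.
have [h hP] := choice (fun k : K => g_surj (f << k >>)).
exists (freem_lift h) => x.
pose gh : {linear {freeg K / R} -> B} := g \o freem_lift h.
apply: (@freem_lift_uniq K B gh f) => k.
by rewrite -[gh _]/(g (freem_lift h _)) freem_liftU hP.
Qed.

Definition free_cover (C : lmodType R) : {linear {freeg C / R} -> C} :=
  freem_lift id.

Lemma free_cover_surj (C : lmodType R) : surjm (free_cover C).
Proof. by move=> y; exists << y >>; rewrite freem_liftU. Qed.

Lemma kerm_prop (A B : lmodType R) (f : {linear A -> B}) :
  submod_prop (fun x => f x = 0).
Proof.
split=> [|x y fx fy|a x fx]; first exact: linear0.
- by rewrite linearD fx fy addr0.
- by rewrite linearZ_LR fx scaler0.
Qed.

Lemma free_cover_ker (A B : lmodType R) (f : {linear A -> B}) :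
  exists (P : lmodType R) (d : {linear P -> A}), projective P /\ exactm d f.
Proof.
pose K := submod_of (kerm_prop f).
exists {freeg (subm K) / R}.
exists (subm_incl K \o free_cover (subm K) : {linear _ -> _}).
split=> [|y]; first exact: free_projective.
split=> [fy0|[x <-]].
  have yK : y \in K by apply/submod_ofP.
  by have [x hx] := free_cover_surj (exist _ y yK : subm K); exists x;
    exact: (congr1 (subm_incl K) hx).
exact/(submod_ofP (kerm_prop f))/(valP (free_cover (subm K) x)).
Qed.

Lemma resolution_ex (C : lmodType R) :
  exists (P2 P1 P0 : lmodType R) (d2 : {linear P2 -> P1})
    (d1 : {linear P1 -> P0}) (e : {linear P0 -> C}), resolution d2 d1 e.
Proof.
have [P1 [d1 [pP1 ex1]]] := free_cover_ker (free_cover C).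
have [P2 [d2 [pP2 ex2]]] := free_cover_ker d1.
exists P2, P1, {freeg C / R}, d2, d1, (free_cover C).
by split; split=> //; [exact: free_projective | exact: free_cover_surj].
Qed.

End Homological.

Section LocalRing.
Context {R : comNzRingType}.

Definition maximal_ideal (I : submodClosed R^o) : Prop :=
  1 \notin I /\
  forall J : submodClosed R^o, 1 \notin J -> {subset I <= J} -> J =i I.

Definition local_ring (m : submodClosed R^o) : Prop :=
  maximal_ideal m /\
  forall I : submodClosed R^o, maximal_ideal I -> I =i m.

End LocalRing.

Definition noetherian (R : comNzRingType) : Prop :=
  forall I : nat -> submodClosed R^o,
    (forall n, {subset I n <= I n.+1}) ->
    exists n, forall k, (n <= k)%N -> I k =i I n.

Section AdicTopology.
Context {R : comNzRingType} (m : submodClosed R^o).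

Definition ideal_exp (n : nat) : submodClosed R^o :=
  iter n (smulm m) (fullm R^o).

Definition powm (n : nat) (A : lmodType R) : submodClosed A :=
  smulm (ideal_exp n) (fullm A).

Lemma hsubm_prop (A : lmodType R) :
  submod_prop (fun x : A => forall n, (0 < n)%N -> x \in powm n A).
Proof.
split=> [n _|x y hx hy n n0|a x hx n n0]; first exact: rpred0.
- by rewrite rpredD ?hx ?hy.
- by rewrite rpredZ ?hx.
Qed.

Definition hsubm (A : lmodType R) : submodClosed A :=
  submod_of (hsubm_prop A).

Definition separated (A : lmodType R) : Prop :=
  forall x, x \in hsubm A -> x = 0.

Definition radical_full (A : lmodType R) : Prop :=
  smulm m (fullm A) =i fullm A.

(* P(A), as the sum of all radical-full submodules of A; it is the largest   *)
(* one by [psubm_radical_full] and [psubm_max].                              *)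
Definition psubm (A : lmodType R) : submodClosed A :=
  spanm (fun x => exists2 S : submodClosed A, radical_full (subm S) & x \in S).

Lemma psubm_max (A : lmodType R) (S : submodClosed A) :
  radical_full (subm S) -> {subset S <= psubm A}.
Proof. by move=> rS x xS; apply: spanm_sub; exists S. Qed.

Lemma smulmS (A : lmodType R) (I J : submodClosed R^o) (S T : submodClosed A) :
  {subset I <= J} -> {subset S <= T} -> {subset smulm I S <= smulm J T}.
Proof.
move=> IJ ST; apply: spanm_min => _ [a [x [aI xS ->]]].
by apply: spanm_sub; exists a, x; split; [exact: IJ | exact: ST |].
Qed.

Lemma fullmP (A : lmodType R) (x : A) : x \in fullm A.
Proof. exact/submod_ofP. Qed.

Lemma radical_full_subm (A : lmodType R) (S : submodClosed A) :
  radical_full (subm S) <-> {subset S <= smulm m S}.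
Proof.
split=> [rS x xS|rS u].
  have T_prop : submod_prop (fun u : subm S => \val u \in smulm m S).
    split=> [|u v hu hv|a u hu]; first by rewrite linear0 rpred0.
      by rewrite linearD rpredD.
    by rewrite linearZ rpredZ.
  pose u : subm S := exist _ x xS.
  suff : u \in submod_of T_prop by move/submod_ofP.
  have : u \in smulm m (fullm (subm S)) by rewrite rS fullmP.
  apply: spanm_min => _ [a [v [am _ ->]]]; apply/submod_ofP.
  by rewrite linearZ; apply: spanm_sub; exists a, (\val v); rewrite (valP v).
rewrite fullmP; case: u => x xS.
have T_prop : submod_prop (fun y => exists2 v : subm S, \val v = y &
    v \in smulm m (fullm (subm S))).
  split=> [|_ _ [u <- hu] [v <- hv]|a _ [u <- hu]].
  - by exists 0; rewrite ?linear0 ?rpred0.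
  - by exists (u + v); rewrite ?linearD ?rpredD.
  - by exists (a *: u); rewrite ?linearZ ?rpredZ.
suff : x \in submod_of T_prop.
  by case/submod_ofP => v vx; suff -> : exist _ x xS = v by []; apply: val_inj.
move: (rS x xS); apply: spanm_min => _ [a [y [am yS ->]]]; apply/submod_ofP.
exists (a *: (exist _ y yS : subm S)); first by rewrite linearZ.
by apply: spanm_sub; exists a, (exist _ y yS : subm S); rewrite fullmP.
Qed.

Lemma psubm_radical_full (A : lmodType R) : radical_full (subm (psubm A)).
Proof.
apply/radical_full_subm; apply: spanm_min => x [S rS xS].
apply: (@smulmS _ m m S (psubm A)) => //; first exact: psubm_max.
by move/radical_full_subm: rS; exact.
Qed.

Lemma powmS (A : lmodType R) n : {subset powm n.+1 A <= powm n A}.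
Proof.
apply: smulmS => // x; rewrite [x \in ideal_exp n.+1]/(x \in smulm m _).
apply: spanm_min => _ [a [y [_ yn ->]]]; exact: rpredZ.
Qed.

End AdicTopology.

Section Completion.
Context {R : comNzRingType}.

Section Product.
Variable T : nat -> lmodType R.

Definition prodm := forall n, T n.

HB.instance Definition _ := gen_eqMixin prodm.
HB.instance Definition _ := gen_choiceMixin prodm.

Let prod_ext (x y : prodm) : (forall n, x n = y n) -> x = y.
Proof. exact: functional_extensionality_dep. Qed.

Let addA : associative (fun x y : prodm => (fun n => x n + y n) : prodm).
Proof. by move=> x y z; apply: prod_ext => n; rewrite addrA. Qed.
Let addC : commutative (fun x y : prodm => (fun n => x n + y n) : prodm).
Proof. by move=> x y; apply: prod_ext => n; rewrite addrC. Qed.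
Let add0 : left_id ((fun n => 0) : prodm)
  (fun x y : prodm => (fun n => x n + y n) : prodm).
Proof. by move=> x; apply: prod_ext => n; rewrite add0r. Qed.
Let addN : left_inverse ((fun n => 0) : prodm)
  (fun x : prodm => (fun n => - x n) : prodm)
  (fun x y : prodm => (fun n => x n + y n) : prodm).
Proof. by move=> x; apply: prod_ext => n; rewrite addNr. Qed.

HB.instance Definition _ := GRing.isZmodule.Build prodm addA addC add0 addN.

Let scale (a : R) (x : prodm) : prodm := fun n => a *: x n.
Let scaleA a b x : scale a (scale b x) = scale (a * b) x.
Proof. by apply: prod_ext => n; rewrite /scale scalerA. Qed.
Let scale1 : left_id 1 scale.
Proof. by move=> x; apply: prod_ext => n; rewrite /scale scale1r. Qed.
Let scaleDr : right_distributive scale +%R.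
Proof. by move=> a x y; apply: prod_ext => n; rewrite /scale scalerDr. Qed.
Let scaleDl x : {morph scale^~ x : a b / a + b}.
Proof. by move=> a b; apply: prod_ext => n; rewrite /scale scalerDl. Qed.

HB.instance Definition _ :=
  GRing.Zmodule_isLmodule.Build R prodm scaleA scale1 scaleDr scaleDl.

End Product.

Variables (m : submodClosed R^o) (M : lmodType R).

Lemma transm_subproof n x : x \in powm m n.+1 M -> quotm_proj (powm m n M) x = 0.
Proof. by move=> /powmS xn; apply/eqP; rewrite quotm_projP. Qed.

Definition transm n : {linear quotm (powm m n.+1 M) -> quotm (powm m n M)} :=
  quotm_lift (@transm_subproof n).

Lemma coherent_prop : submod_prop (fun x : prodm (fun n => quotm (powm m n M)) =>
  forall n, transm n (x n.+1) = x n).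
Proof.
split=> [n|x y hx hy n|a x hx n]; first exact: linear0.
- by rewrite -[RHS]/(x n + y n) -(hx n) -(hy n); exact: linearD.
- by rewrite -[RHS]/(a *: x n) -(hx n); exact: linearZ.
Qed.

(* Starting the limit at n = 0 is harmless, since m^0 M = M.                 *)
Definition completion := subm (submod_of coherent_prop).

End Completion.

(* Main.v *)
Require Import Defs.
From HB Require Import structures.
From mathcomp Require Import all_boot all_algebra.
From mathcomp Require Import boolp classical_sets.
From mathcomp Require Import freeg.
Import GRing.Theory.
Local Open Scope ring_scope.

(** A pure-injective module is algebraically compact: a system of linear
equations, with any number of unknowns in N, is solvable as soon as its finite
parts are ([pure_injective_system]). Ideals being finitely generated, the
same holds for congruences modulo submodules J N
([pure_injective_congruences]). Each step below solves such a system.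

N1 is the m-adic closure T of M in N. It lies in T because P = N1/M satisfies
P = m^n P, so that N1 = M + m^n N1. Conversely, T/M is radical-full
([closm_decomposition]): an x in T is a limit of some a_n in M; by purity of M
the differences a_(n+1) - a_n lie in m^(n+1) M, and distributing them over
generators r_i of m gives x - a_0 = sum_i r_i y_i, where each y_i is again a
limit of a sequence of M.

Every closed submodule T of N is cotorsion ([closed_cotorsion]). Let
0 -> K -> F -> C -> 0 be exact with F free and C flat, and let ka : K -> T.
There are maps ph : F -> K which fix any given finite part of K, by flatness
([flat_fix]), and maps psi_n : F -> K which form an m-adic Cauchy sequence and
are the identity of K modulo m^n K; the latter are sums of a geometric series
built from a vector space complement of K modulo m
([approximate_retractions]). The conditions th = ka on K and
th = ka psi_n modulo m^n N on a basis of F are finitely solvable, namely by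
th = ka (psi_n + (1 - psi_n) ph); a solution extends ka, and it takes its
values in T because T is closed.

Finally N1 = M + m^n N1 and, by purity, the intersection of M and m^n N1 is
m^n M. So M and N1 have the same quotients modulo m^n, and all Cauchy sequences
of M converge in N1; sending such a sequence to its limit is the isomorphism of
the completion of M onto N1/H(N1) ([completion_iso]). *)

Set Implicit Arguments.
Unset Strict Implicit.
Unset Printing Implicit Defensive.

(** * Linear maps and tensor products *)

Section Tensor.
Context {R : comNzRingType}.
Implicit Types A B C G N : lmodType R.

Definition linear_of A B (f : A -> B) (f_lin : linear f) : {linear A -> B} :=
  HB.pack f (GRing.isLinear.Build R A B _ f f_lin).

Lemma val_submD A (S : submodClosed A) (x y : subm S) :
  \val (x + y) = \val x + \val y.
Proof. by []. Qed.

Lemma val_submB A (S : submodClosed A) (x y : subm S) :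
  \val (x - y) = \val x - \val y.
Proof. by []. Qed.

Lemma surjm_proj A (S : submodClosed A) : surjm (quotm_proj S).
Proof. by move=> y; exists (quotm_repr y); exact: quotm_reprK. Qed.

Lemma copair_linear A B C (f : {linear A -> C}) (g : {linear B -> C}) :
  linear (fun p : A * B => f p.1 + g p.2).
Proof.
by move=> c p q; rewrite (linearP f) (linearP g) scalerDr addrACA.
Qed.

Definition copair A B C (f : {linear A -> C}) (g : {linear B -> C}) :
  {linear (A * B)%type -> C} := linear_of (copair_linear f g).

Lemma inlm_linear A B : linear (fun x : A => ((x, 0) : A * B)).
Proof. by move=> c p q; congr pair; rewrite /= scaler0 addr0. Qed.

Definition inlm A B : {linear A -> (A * B)%type} :=
  linear_of (@inlm_linear A B).

Lemma inrm_linear A B : linear (fun x : B => ((0, x) : A * B)).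
Proof. by move=> c p q; congr pair; rewrite /= scaler0 addr0. Qed.

Definition inrm A B : {linear B -> (A * B)%type} :=
  linear_of (@inrm_linear A B).

Lemma corestrict A B (S : submodClosed B) (f : {linear A -> B}) :
  (forall x, f x \in S) ->
  exists g : {linear A -> subm S}, forall x, \val (g x) = f x.
Proof.
move=> fS; pose g x : subm S := exist _ (f x) (fS x).
have g_lin : linear g.
  by move=> a x y; apply: val_inj; rewrite [RHS]linearP -[LHS]/(f _) linearP.
by exists (linear_of g_lin).
Qed.

Lemma linear_bij_inv A B (f : {linear A -> B}) :
  injective f -> surjm f ->
  exists g : {linear B -> A}, cancel f g /\ cancel g f.
Proof.
move=> f_inj /choice[g gK].
have g_lin : linear g by move=> a x y; apply: f_inj; rewrite linearP !gK.
by exists (linear_of g_lin); split=> // x;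
  apply: f_inj; exact: gK.
Qed.

Lemma freeg_spanned (K : choiceType) (S : submodClosed {freeg K / R}) x :
  (forall k, << k >> \in S) -> x \in S.
Proof.
move=> hS; rewrite -(quotm_projP S).
pose z : {linear {freeg K / R} -> quotm S} := \0.
have -> : quotm_proj S x = z x; last exact/eqP.
by apply: freem_lift_uniq => k; apply/eqP; rewrite quotm_projP.
Qed.

Lemma tens_ind A B (P : tens A B -> Prop) :
  submod_prop P -> (forall a b, P (tensor a b)) -> forall z, P z.
Proof.
move=> hP Pt z; have [x <-] := surjm_proj z.
pose Q x := P (quotm_proj (spanm (@tens_rel R A B)) x).
have hQ : submod_prop Q.
  case: hP => P0 PD PZ; split; rewrite /Q.
  - by rewrite linear0.
  - by move=> u v Pu Pv; rewrite linearD; exact: PD.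
  - by move=> a u Pu; rewrite linearZ; exact: PZ.
suff : x \in submod_of hQ by move/submod_ofP.
by apply: freeg_spanned => -[a b]; apply/submod_ofP; exact: Pt.
Qed.

Lemma tens_eq A B C (f g : {linear tens A B -> C}) :
  (forall a b, f (tensor a b) = g (tensor a b)) -> f =1 g.
Proof.
move=> fg; apply: tens_ind => //; split=> [|x y fx fy|a x fx].
- by rewrite !linear0.
- by rewrite !linearD fx fy.
- by rewrite !linearZ_LR fx.
Qed.

Lemma tens_map_id A B (f : {linear A -> A}) (g : {linear B -> B}) z :
  f =1 id -> g =1 id -> tens_map f g z = z.
Proof.
move=> f1 g1.
by apply: (tens_eq (g := idfun)) => a b; rewrite tens_mapE f1 g1.
Qed.

Lemma tens_map_comp A A' A'' B B' B'' (f : {linear A -> A'})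
    (f' : {linear A' -> A''}) (h : {linear A -> A''}) (g : {linear B -> B'})
    (g' : {linear B' -> B''}) (k : {linear B -> B''}) z :
  f' \o f =1 h -> g' \o g =1 k ->
  tens_map f' g' (tens_map f g z) = tens_map h k z.
Proof.
move=> fh gk.
apply: (tens_eq (f := tens_map f' g' \o tens_map f g)) => a b.
rewrite -[LHS]/(tens_map f' g' (tens_map f g (tensor a b))).
by rewrite !tens_mapE -fh -gk.
Qed.

Definition bilinear_op A B C (f : A -> B -> C) : Prop :=
  (forall b, linear (f^~ b)) /\ (forall a, linear (f a)).

Lemma tens_lift A B C (f : A -> B -> C) : bilinear_op f ->
  exists h : {linear tens A B -> C}, forall a b, h (tensor a b) = f a b.
Proof.
move=> [fl fr].
pose pre : {linear {freeg (A * B)%type / R} -> C} :=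
  freem_lift (fun p => f p.1 p.2).
have hK x : x \in spanm (@tens_rel R A B) -> pre x = 0.
  move=> /(spanm_min (S := submod_of (kerm_prop pre))) xK.
  apply/(submod_ofP (kerm_prop pre))/xK => _ [a a' b|a b b'|r a b|r a b];
    apply/submod_ofP; apply/eqP;
    rewrite linearB subr_eq0 ?[pre (_ + _)]linearD ?[pre (_ *: _)]linearZ_LR
      !freem_liftU /=.
  - by apply/eqP; exact: (linearD (linear_of (fl b))).
  - by apply/eqP; exact: (linearD (linear_of (fr a))).
  - by apply/eqP; exact: (linearZ_LR (linear_of (fl b))).
  - by apply/eqP; exact: (linearZ_LR (linear_of (fr a))).
exists (quotm_lift hK) => a b.
rewrite [tensor a b]/(quotm_proj _ _) [LHS](quotm_lift_proj hK).
exact: freem_liftU.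
Qed.

(** Right exactness of the tensor product, in both variables at once. The
inverse of the induced map from the quotient by W is given by lifting along [p]
and [q]; it is well defined on pure tensors because changing a lift changes the
tensor by a generator of W. *)
Lemma tens_map_ker A A' B B' (p : {linear A -> A'}) (q : {linear B -> B'}) z :
  surjm p -> surjm q -> tens_map p q z = 0 ->
  z \in spanm (fun t => exists a b, t = tensor a b /\ (p a = 0 \/ q b = 0)).
Proof.
move=> /choice[s sK] /choice[t tK]; set W := spanm _ => z0.
have WP a b : p a = 0 \/ q b = 0 -> tensor a b \in W.
  by move=> h; apply: spanm_sub; exists a, b.
have tW a b a' b' : p a = p a' -> q b = q b' ->
    quotm_proj W (tensor a b) = quotm_proj W (tensor a' b').
  move=> pa qb; apply/quotm_proj_eq.
  have -> : tensor a b - tensor a' b' = tensor (a - a') b + tensor a' (b - b').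
    rewrite -!scaleN1r tensorDl tensorDr tensorZl tensorZr !scaleN1r.
    by rewrite addrA subrK.
  by rewrite rpredD//; apply: WP; [left | right];
    rewrite linearB ?pa ?qb subrr.
have f_bil : bilinear_op (fun a' b' => quotm_proj W (tensor (s a') (t b'))).
  split=> [b'|a'] c u v /=.
    rewrite -linearP -tensorZl -tensorDl; apply: tW => //.
    by rewrite linearP !sK.
  rewrite -linearP -tensorZr -tensorDr; apply: tW => //.
  by rewrite linearP !tK.
have [h hP] := tens_lift f_bil.
rewrite -(quotm_projP W); apply/eqP.
transitivity (h (tens_map p q z)); last by rewrite z0 linear0.
apply: (@tens_eq A B _ (quotm_proj W) (h \o tens_map p q)) => a b.
rewrite -[RHS]/(h (tens_map p q (tensor a b))) tens_mapE hP.
by apply: tW; rewrite ?sK ?tK.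
Qed.

End Tensor.

(** * Algebraic compactness of pure-injective modules *)

Section Compactness.
Context {R : comNzRingType}.
Implicit Types A B C F G N : lmodType R.

(** Membership in a span only involves finitely many generators; stating the
conclusion for all submodules spares an explicit linear combination. *)
Lemma span_finite G (I : eqType) (g : I -> G) x :
  x \in spanm (fun y => exists i, y = g i) ->
  exists s : seq I,
    forall S : submodClosed G, (forall i, i \in s -> g i \in S) -> x \in S.
Proof.
set Q := fun x => exists s : seq I,
  forall S : submodClosed G, (forall i, i \in s -> g i \in S) -> x \in S.
have hQ : submod_prop Q.
  split=> [|u v [s hs] [t ht]|a u [s hs]].
  - by exists [::] => S _; exact: rpred0.
  - exists (s ++ t) => S hS.
    by rewrite rpredD ?hs ?ht// => i ii; rewrite hS// mem_cat ii ?orbT.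
  - by exists s => S hS; rewrite rpredZ ?hs.
move=> xg; apply/(submod_ofP hQ); apply: (spanm_min _ xg) => _ [i ->].
by apply/submod_ofP; exists [:: i] => S; apply; rewrite inE.
Qed.

(** Adjoin a generic solution to N: let B be the quotient of N + F by the
relations a i = f i. Finite solvability says that every finite set of relations
is killed by a retraction of N + F onto N. An element of X (x) N that vanishes
in X (x) B is a combination of finitely many relations, by right exactness,
hence it is zero. So N is pure in B, and a retraction of B onto N is a
solution. *)
Lemma pure_injective_system N F (I : eqType) (f : I -> F) (a : I -> N) :
  pure_injective N ->
  (forall s : seq I, exists th : {linear F -> N},
     forall i, i \in s -> th (f i) = a i) ->
  exists th : {linear F -> N}, forall i, th (f i) = a i.
Proof.
move=> N_pi fin_sol.
pose G : lmodType R := (N * F)%type.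
pose g i : G := (a i, - f i).
pose S := spanm (fun y => exists i, y = g i).
(* A finite solution th yields the retraction (n, x) |-> n + th x. *)
have retr (s : seq I) : exists rho : {linear G -> N},
    (forall n, rho (n, 0) = n) /\ (forall i, i \in s -> rho (g i) = 0).
  have [th thP] := fin_sol s.
  exists (copair idfun th); split=> [n|i /thP fi].
    by rewrite -[LHS]/(n + th 0) linear0 addr0.
  by rewrite -[LHS]/(a i + th (- f i)) linearN fi subrr.
pose inl : {linear N -> G} := inlm N F.
pose j0 : {linear N -> quotm S} := quotm_proj S \o inl.
pose A := imagem j0 (fullm N).
have j0A n : j0 n \in A by apply/submod_ofP; exists n; rewrite ?fullmP.
have [j jE] := corestrict j0A.
have j_inj : injective j.
  move=> n n' /(congr1 val); rewrite !jE => jn.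
  apply/eqP; rewrite -subr_eq0; apply/eqP.
  have : inl (n - n') \in S.
    by rewrite -quotm_projP; apply/eqP; rewrite 2!linearB; apply/eqP;
      rewrite subr_eq0; apply/eqP.
  move=> /span_finite[s hs]; have [rho [rho_id rho_s]] := retr s.
  rewrite -[LHS]rho_id; apply/(submod_ofP (kerm_prop rho)); apply: hs => i si.
  by apply/submod_ofP; exact: rho_s.
have j_surj : surjm j.
  move=> [y yA]; have /submod_ofP[n _ yn] := yA.
  by exists n; apply: val_inj; rewrite jE.
have [k [jK kK]] := linear_bij_inv j_inj j_surj.
have A_pure : pure A.
  move=> X; set T := tens_map _ _.
  suff T0 z : T z = 0 -> z = 0.
    by move=> z z' /eqP; rewrite -subr_eq0 -linearB => /eqP/T0/eqP;
      rewrite subr_eq0 => /eqP.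
  pose idX : {linear X -> X} := idfun.
  have zE : z = tens_map idX j (tens_map idX k z).
    by rewrite (tens_map_comp (h := idfun) (k := idfun)) ?tens_map_id.
  rewrite {1}zE => Tz; set z' := tens_map idX k z in zE Tz.
  have {}Tz : tens_map idX (quotm_proj S) (tens_map idX inl z') = 0.
    rewrite -[RHS]Tz.
    by rewrite !(tens_map_comp (h := idX) (k := j0)).
  have idX_surj : surjm idX by move=> x; exists x.
  have tS := tens_map_ker idX_surj (@surjm_proj R _ S) Tz.
  pose P (t : tens X G) := exists s : seq I, forall rho : {linear G -> N},
    (forall i, i \in s -> rho (g i) = 0) -> tens_map idX rho t = 0.
  have hP : submod_prop P.
    split=> [|u v [s hs] [t ht]|c u [s hs]].
    - by exists [::] => rho _; rewrite linear0.
    - exists (s ++ t) => rho hrho; rewrite linearD hs ?ht ?addr0// => i ii;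
        by apply: hrho; rewrite mem_cat ii ?orbT.
    - by exists s => rho hrho; rewrite linearZ_LR hs// scaler0.
  have /submod_ofP[s hs] : tens_map idX inl z' \in submod_of hP.
    apply: (spanm_min _ tS) => _ [x [b [-> xb]]].
    apply/submod_ofP; case: xb => [x0|/eqP].
      exists [::] => rho _; rewrite tens_mapE x0.
      by rewrite -[0](scale0r 0) tensorZl scale0r.
    rewrite quotm_projP => /span_finite[s hs]; exists s => rho rho_s.
    rewrite tens_mapE; suff -> : rho b = 0.
      by rewrite -[0](scale0r 0) tensorZr scale0r.
    apply/(submod_ofP (kerm_prop rho)); apply: hs => i /rho_s ?.
    exact/submod_ofP.
  have [rho [rho_id /hs z'0]] := retr s.
  have z'E : tens_map idX rho (tens_map idX inl z') = z'.
    by rewrite (tens_map_comp (h := idfun) (k := idfun)) ?tens_map_id.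
  by rewrite zE -z'E z'0 linear0.
have [h hP] := N_pi _ _ A_pure k.
pose inr : {linear F -> G} := inrm N F.
exists (h \o quotm_proj S \o inr : {linear F -> N}) => i.
have e : j0 (a i) = quotm_proj S (inr (f i)).
  apply/quotm_proj_eq; have -> : inl (a i) - inr (f i) = g i.
    by congr pair; rewrite /= ?subr0 ?sub0r.
  by apply: spanm_sub; exists i.
by rewrite -[LHS]/(h (quotm_proj S (inr (f i)))) -e -jE hP jK.
Qed.

End Compactness.

(** * Congruences over a noetherian ring *)

Section Congruences.
Context {R : comNzRingType}.
Implicit Types (F G N : lmodType R) (I J : submodClosed R^o).

Definition generates (J : submodClosed R^o) (s : seq R^o) : Prop :=
  {subset s <= J} /\ {subset J <= spanm (fun x : R^o => x \in s)}.

(** Otherwise, adding to a finite part of J elements of J outside its span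
gives a strictly increasing chain of ideals. *)
Lemma noetherian_fg (R_noetherian : noetherian R) J : exists s, generates J s.
Proof.
apply: contrapT => no_gens.
have /choice[step stepP] : forall s : seq R^o, exists x, {subset s <= J} ->
    x \in J /\ x \notin spanm (fun x : R^o => x \in s).
  move=> s.
  apply: contrapT => no_x; apply: no_gens; exists s; split=> [y ys|y yJ].
    by apply: contrapT => yJ; apply: no_x; exists 0 => /(_ y ys).
  apply: contrapT => ys; apply: no_x; exists y => _; split=> //; exact/negP.
pose l n := iter n (fun s => step s :: s) [::].
have lJ n : {subset l n <= J}.
  elim: n => [|n IHn] y //=; rewrite inE => /predU1P[->|/IHn//].
  by have [] := stepP _ IHn.
have [|n /(_ n.+1 (leqnSn n)) chain] :=
    R_noetherian (fun n => spanm (fun x : R^o => x \in l n)).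
  move=> n; apply: spanm_min => y yl; apply: spanm_sub.
  by rewrite inE yl orbT.
have [_ /negP[]] := stepP _ (lJ n); rewrite -(chain (step (l n))).
by apply: spanm_sub; rewrite inE eqxx.
Qed.

Lemma smulmP (J : submodClosed R^o) s N (S : submodClosed N) z :
  generates J s -> z \in smulm J S <->
  exists y : nat -> N, (forall i, y i \in S) /\
    z = \sum_(i < size s) (s`_i : R) *: y i.
Proof.
move=> [sJ Js]; split; last first.
  move=> [y [yS ->]]; apply: rpred_sum => i _.
  by apply: spanm_sub; exists s`_i, (y i); rewrite sJ ?mem_nth.
pose Q z := exists y : nat -> N, (forall i, y i \in S) /\
    z = \sum_(i < size s) (s`_i : R) *: y i.
have hQ : submod_prop Q.
  split=> [|u v [x [xS ->]] [y [yS ->]]|c u [x [xS ->]]].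
  - exists (fun=> 0); split=> [i|]; first exact: rpred0.
    by rewrite big1// => i _; rewrite scaler0.
  - exists (fun i => x i + y i); split=> [i|]; first by rewrite rpredD.
    by rewrite -big_split; apply: eq_bigr => i _; rewrite scalerDr.
  - exists (fun i => c *: x i); split=> [i|]; first by rewrite rpredZ.
    by rewrite scaler_sumr; apply: eq_bigr => i _; rewrite !scalerA mulrC.
suff : {subset smulm J S <= submod_of hQ} by move=> h /h/submod_ofP.
apply: spanm_min => _ [a [x [aJ xS ->]]].
have hI : submod_prop (fun a : R^o => (a : R) *: x \in submod_of hQ).
  split=> [|b c hb hc|b c hc]; first by rewrite scale0r rpred0.
    by rewrite scalerDl rpredD.
  by rewrite -[b *: c]/((b : R) * c) -scalerA rpredZ.
suff /submod_ofP : (a : R^o) \in submod_of hI by [].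
apply: (spanm_min _ (Js _ aJ)) => b bs; apply/submod_ofP/submod_ofP.
have ib : (index b s < size s)%N by rewrite index_mem.
exists (fun i => if i == index b s then x else 0); split=> [i|].
  by case: ifP; rewrite ?rpred0.
rewrite (bigD1 (Ordinal ib))//= eqxx nth_index// big1 ?addr0// => i.
by rewrite -val_eqE /= => /negbTE ->; rewrite scaler0.
Qed.

(** A congruence modulo J N becomes an equation after the adjunction of one new
unknown for each generator of J. *)
Lemma pure_injective_congruences N F (I : choiceType) (f : I -> F) (a : I -> N)
    (J : I -> submodClosed R^o) :
  noetherian R -> pure_injective N ->
  (forall s : seq I, exists th : {linear F -> N},
     forall i, i \in s -> th (f i) - a i \in smulm (J i) (fullm N)) ->
  exists th : {linear F -> N},
     forall i, th (f i) - a i \in smulm (J i) (fullm N).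
Proof.
move=> R_noetherian N_pi fin_sol.
have [gen genP] := choice (fun i => noetherian_fg R_noetherian (J i)).
(* The unknowns (i, j) are the coefficients of th (f i) - a i over the
   generators of J i. *)
pose W : lmodType R := {freeg (I * nat)%type / R}.
pose w i : W := \sum_(j < size (gen i)) ((gen i)`_j : R) *: << (i, j : nat) >>.
have [|th thP] := @pure_injective_system R N (F * W)%type I
  (fun i => (f i, - w i)) a N_pi.
  move=> s; have [th thP] := fin_sol s.
  have /choice[y yP] : forall i, exists yi : nat -> N, i \in s ->
      th (f i) - a i = \sum_(j < size (gen i)) ((gen i)`_j : R) *: yi j.
    move=> i.
    have [/thP/(smulmP _ _ (genP i))[yi [_ yiE]]|] := boolP (i \in s).
      by exists yi.
    by exists (fun=> 0).
  pose ph : {linear W -> N} := freem_lift (fun p => y p.1 p.2).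
  exists (copair th ph) => i si.
  rewrite -[LHS]/(th (f i) + ph (- w i)) linearN.
  suff -> : ph (w i) = th (f i) - a i by rewrite opprB addrC subrK.
  rewrite yP// linear_sum; apply: eq_bigr => j _.
  by rewrite linearZ_LR freem_liftU.
exists (th \o inlm F W) => i; apply/(smulmP _ _ (genP i)).
exists (fun j => th (inrm F W << (i, j) >>)).
split=> [j|]; first exact: fullmP.
rewrite -(thP i) -[LHS]/(th (f i, 0) - th (f i, - w i)) -linearB.
have -> : (f i, 0) - (f i, - w i) = inrm F W (w i) :> F * W.
  by congr pair; rewrite /= ?subrr ?sub0r ?opprK.
rewrite [inrm F W _]linear_sum linear_sum; apply: eq_bigr => j _.
by rewrite !linearZ_LR.
Qed.

Definition zero_ideal : submodClosed R^o := spanm (fun=> False).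

(** Lets exact equations be stated as congruences. *)
Lemma smulm_zero N (S : submodClosed N) x : x \in smulm zero_ideal S -> x = 0.
Proof.
have no_gens : generates zero_ideal [::].
  by split=> // a; apply: spanm_min.
by move=> /(smulmP _ _ no_gens)[y [_ ->]]; rewrite big_ord0.
Qed.

Lemma seq_bound (T : eqType) (g : T -> nat) (s : seq T) :
  exists n, forall i, i \in s -> (g i <= n)%N.
Proof.
exists (\max_(i <- s) g i) => i si; exact: leq_bigmax_seq.
Qed.

End Congruences.

(** * Finite splittings of flat quotients of free modules *)

Section Flat.
Context {R : comNzRingType}.

Lemma freeg_sumZ (E : choiceType) (x : {freeg E / R}) :
  x = \sum_(b <- dom x) coeff b x *: << b >>.
Proof.
rewrite -[LHS]freeg_sumE; apply: eq_bigr => b _.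
by apply/eqP/freeg_eqP => y; rewrite coeffZ !coeffU mul1r.
Qed.

(** Let k = sum_b r_b b, summed over the basis elements b in the support of k.
The relation sum_b r_b (e b) = 0 in the flat module C comes from relations
among the r_b: there are elements f_j of F and coefficients a_bj with e b =
sum_j a_bj (e f_j) and sum_b r_b a_bj = 0. This is the injectivity of I (x) C
-> C for the ideal I spanned by the r_b, written as the quotient of F by the
kernel L of the functional b |-> r_b. The map ph then sends b to b - D b, where
D b = sum_j a_bj f_j. *)
Lemma flat_fix1 (E : choiceType) (C : lmodType R)
    (e : {linear {freeg E / R} -> C}) k : flat C -> surjm e -> e k = 0 ->
  exists ph : {linear {freeg E / R} -> {freeg E / R}},
    (forall x, e (ph x) = 0) /\ ph k = k.
Proof.
move=> C_flat e_surj ek; pose F : lmodType R := {freeg E / R}.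
have sum_dom (M : lmodType R) (f : E -> M) b0 :
    \sum_(b <- dom k) (b == b0)%:R *: f b = (b0 \in dom k)%:R *: f b0.
  have [b0k|b0k] := boolP (b0 \in dom k).
    rewrite (bigD1_seq b0) ?uniq_dom//= eqxx big1 ?addr0// => b /negbTE ->.
    by rewrite scale0r.
  rewrite scale0r big1_seq// => b /= bk; suff -> : b == b0 = false.
    by rewrite scale0r.
  by apply: contraNF b0k => /eqP <-.
have la_lin : linear
    (fun x : F => \sum_(b <- dom k) coeff b x * coeff b k : R^o).
  move=> c x y; rewrite scaler_sumr -big_split; apply: eq_bigr => b _ /=.
  by rewrite coeffD coeffZ mulrDl -mulrA.
pose la : {linear F -> R^o} := linear_of la_lin.
have laU b : b \in dom k -> la << b >> = coeff b k.
  move=> bk; rewrite -[LHS]/(\sum_(b' <- dom k) _ * _).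
  under eq_bigr => b' do rewrite coeffU mul1r eq_sym.
  by rewrite (sum_dom R^o (fun b => coeff b k)) bk scale1r.
pose L := submod_of (kerm_prop la).
have laL x : x \in L -> la x = 0 by move/submod_ofP.
pose t : tens F C := \sum_(b <- dom k) tensor (<< b >> : F) (e << b >>).
have t0 : tens_map (quotm_proj L) (idfun : {linear C -> C}) t = 0.
  have laq_inj : injective (quotm_lift laL).
    move=> x y; rewrite -[x]quotm_reprK -[y]quotm_reprK.
    rewrite ![quotm_lift _ _](quotm_lift_proj laL) => xy.
    by apply/quotm_proj_eq/submod_ofP; rewrite linearB xy subrr.
  apply: (C_flat _ _ _ laq_inj); rewrite linear0 !linear_sum.
  transitivity (tensor (1 : R^o) (e k)); last first.
    by rewrite ek -[0](scale0r 0) tensorZr scale0r.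
  rewrite [k in RHS]freeg_sumZ linear_sum.
  have tl : linear (tensor (1 : R^o) : C -> _).
    by move=> c x y; rewrite tensorDr tensorZr.
  rewrite [RHS](linear_sum (linear_of tl)); apply: eq_big_seq => b bk.
  rewrite !tens_mapE [X in tensor X _](quotm_lift_proj laL) laU//.
  rewrite linearZ_LR -[RHS]/(tensor _ (_ *: _)) tensorZr -tensorZl.
  by congr (tensor _ _); exact: esym (mulr1 _).
(* P z: the coefficients of z define admissible corrections D, where [h] is the
   map x (x) c |-> (coordinate of x at b) c. *)
pose P (z : tens F C) := exists D : E -> F,
  (\sum_(b <- dom k) coeff b k *: D b = 0) /\
  forall b (h : {linear tens F C -> C}),
    (forall x c, h (tensor x c) = coeff b x *: c) -> e (D b) = h z.
have hP : submod_prop P.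
  split=> [|u v [D [D0 DP]] [D' [D'0 D'P]]|c u [D [D0 DP]]].
  - exists (fun=> 0); split=> [|b h _]; last by rewrite !linear0.
    by rewrite big1// => b _; rewrite scaler0.
  - exists (fun b => D b + D' b); split=> [|b h hh].
      under eq_bigr => b _ do rewrite scalerDr.
      by rewrite big_split/= D0 D'0 addr0.
    by rewrite !linearD (DP b h) ?(D'P b h).
  - exists (fun b => c *: D b); split=> [|b h hh].
      under eq_bigr => b _ do rewrite scalerA mulrC -scalerA.
      by rewrite -scaler_sumr D0 scaler0.
    by rewrite !linearZ_LR (DP b h).
have idC_surj : surjm (idfun : {linear C -> C}) by move=> c; exists c.
have tS := tens_map_ker (@surjm_proj R _ L) idC_surj t0.
have /submod_ofP[D [D0 DP]] : t \in submod_of hP.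
  apply: (spanm_min _ tS) => _ [x [c [-> xc]]]; apply/submod_ofP.
  case: xc => [/eqP|c0].
    rewrite quotm_projP => /laL lax.
    have [f fc] := e_surj c; exists (fun b => coeff b x *: f).
    split; last first.
      by move=> b h ->; rewrite linearZ_LR fc.
    rewrite -[RHS](scale0r f) -lax scaler_suml; apply: eq_bigr => b _.
    by rewrite scalerA mulrC.
  exists (fun=> 0); split=> [|b h ->].
    by rewrite big1// => b _; rewrite scaler0.
  by rewrite -[c]/(idfun c) c0 scaler0 linear0.
pose ph : {linear F -> F} :=
  freem_lift (fun b => if b \in dom k then << b >> - D b else 0).
exists ph; split=> [|]; last first.
  rewrite {1}[k]freeg_sumZ linear_sum.
  transitivity (\sum_(b <- dom k) (coeff b k *: << b >> - coeff b k *: D b)).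
    apply: eq_big_seq => b bk.
    by rewrite linearZ_LR [ph _]freem_liftU bk scalerBr.
  by rewrite sumrB D0 subr0 -freeg_sumZ.
apply: (@freem_lift_uniq R E C (e \o ph) \0) => b.
rewrite -[LHS]/(e (ph << b >>)) -[RHS]/0 [ph _]freem_liftU.
case: ifP => bk; last exact: linear0.
have h_bil : bilinear_op (fun (x : F) (c : C) => coeff b x *: c).
  split=> [c|x] a u v; first by rewrite coeffD coeffZ scalerDl scalerA.
  by rewrite scalerDr !scalerA mulrC.
have [h hP'] := tens_lift h_bil.
rewrite linearB (DP b h hP') linear_sum.
under eq_bigr => b' _ do rewrite hP' coeffU mul1r.
by rewrite (sum_dom C (fun b' => e << b' >>)) bk scale1r subrr.
Qed.

(** If ph fixes s and ps fixes k - ph k, then 1 - (1 - ps)(1 - ph) fixes s and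
k. *)
Lemma flat_fix (E : choiceType) (C : lmodType R)
    (e : {linear {freeg E / R} -> C}) (s : seq {freeg E / R}) :
  flat C -> surjm e -> (forall k, k \in s -> e k = 0) ->
  exists ph : {linear {freeg E / R} -> {freeg E / R}},
    (forall x, e (ph x) = 0) /\ forall k, k \in s -> ph k = k.
Proof.
move=> C_flat e_surj; elim: s => [|k s IHs] sK.
  by exists \0; split=> // x; rewrite linear0.
have [|ph [phK ph_id]] := IHs; first by move=> l ls; rewrite sK// inE ls orbT.
have [|ps [psK ps_id]] := @flat_fix1 E C e (k - ph k) C_flat e_surj.
  by rewrite linearB phK subr0 sK// mem_head.
exists (ph \+ (ps \- (ps \o ph))); split=> [x|l].
  by rewrite !linearD phK add0r linearN !psK subr0.
rewrite /= inE => /predU1P[->|/ph_id ->]; last by rewrite subrr addr0.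
by rewrite -linearB ps_id addrC subrK.
Qed.

End Flat.

(** * Adic approximation of retractions onto a submodule *)

Section Products.
Context {R : comNzRingType}.
Implicit Types (F G N : lmodType R) (I J m : submodClosed R^o).

Lemma preim_prop G N (f : {linear G -> N}) (S : submodClosed N) :
  submod_prop (fun x => f x \in S).
Proof.
split=> [|x y|a x]; first by rewrite linear0 rpred0.
  by rewrite linearD; exact: rpredD.
by rewrite linearZ_LR; exact: rpredZ.
Qed.

Lemma freeg_image_sub (E : choiceType) N (f : {linear {freeg E / R} -> N})
    (S : submodClosed N) x : (forall b, f << b >> \in S) -> f x \in S.
Proof.
move=> fS; apply/(submod_ofP (preim_prop f S)).
by apply: freeg_spanned => b; exact/submod_ofP.
Qed.

Lemma smulm_sub J G (S : submodClosed G) : {subset smulm J S <= S}.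
Proof. by apply: spanm_min => _ [a [x [_ xS ->]]]; exact: rpredZ. Qed.

Lemma smulm_full G (S : submodClosed G) x :
  x \in S -> x \in smulm (fullm R^o) S.
Proof.
by move=> xS; apply: spanm_sub; exists 1, x; rewrite fullmP scale1r.
Qed.

Lemma smulm_image J G N (f : {linear G -> N}) (S : submodClosed G)
    (T : submodClosed N) x :
  (forall y, y \in S -> f y \in T) -> x \in smulm J S -> f x \in smulm J T.
Proof.
move=> fST xS; apply/(submod_ofP (preim_prop f (smulm J T))).
apply: (spanm_min _ xS) => _ [a [y [aJ yS ->]]]; apply/submod_ofP.
by rewrite linearZ_LR; apply: spanm_sub; exists a, (f y); rewrite fST.
Qed.

Lemma smulmA I J G (S : submodClosed G) :
  smulm I (smulm J S) =i smulm (smulm I J) S.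
Proof.
move=> z; apply/idP/idP => zS.
  apply: (spanm_min _ zS) => _ [a [x [aI xS ->]]].
  have sc_lin : linear (fun y : G => a *: y).
    by move=> c u v; rewrite scalerDr !scalerA mulrC.
  apply/(submod_ofP (preim_prop (linear_of sc_lin) (smulm (smulm I J) S))).
  apply: (spanm_min _ xS) => _ [b [y [bJ yS ->]]]; apply/submod_ofP.
  rewrite -[linear_of _ _]/(a *: (b *: y)) scalerA.
  apply: spanm_sub; exists (a * b), y; split=> //.
  by apply: spanm_sub; exists a, b.
apply: (spanm_min _ zS) => _ [a [x [aIJ xS ->]]].
have sc_lin : linear (fun a : R^o => (a : R) *: x).
  by move=> c b d; rewrite scalerDl scalerA.
apply/(submod_ofP (preim_prop (linear_of sc_lin) (smulm I (smulm J S)))).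
apply: (spanm_min _ aIJ) => _ [b [c [bI cJ ->]]]; apply/submod_ofP.
rewrite -[linear_of _ _]/((b * c) *: x) -scalerA.
apply: spanm_sub; exists b, (c *: x); split=> //.
by apply: spanm_sub; exists c, x.
Qed.

Lemma smulm_subm J G (S : submodClosed G) (x : subm S) :
  x \in smulm J (fullm (subm S)) <-> \val x \in smulm J S.
Proof.
split=> [xJ|].
  by apply: (smulm_image (f := subm_incl S) _ xJ) => y _; exact: valP y.
case: x => x xS /= xJ.
have T_prop : submod_prop (fun y => exists2 v : subm S, \val v = y &
    v \in smulm J (fullm (subm S))).
  split=> [|_ _ [u <- hu] [v <- hv]|a _ [u <- hu]].
  - by exists 0; rewrite ?linear0 ?rpred0.
  - by exists (u + v); rewrite ?linearD ?rpredD.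
  - by exists (a *: u); rewrite ?linearZ ?rpredZ.
suff : x \in submod_of T_prop.
  by case/submod_ofP => v vx; suff -> : exist _ x xS = v by []; apply: val_inj.
apply: (spanm_min _ xJ) => _ [a [y [aJ yS ->]]]; apply/submod_ofP.
exists (a *: (exist _ y yS : subm S)); first by rewrite linearZ.
by apply: spanm_sub; exists a, (exist _ y yS : subm S); rewrite fullmP.
Qed.

Lemma ideal_expS_smulm m n G (S : submodClosed G) :
  smulm (ideal_exp m n.+1) S =i smulm m (smulm (ideal_exp m n) S).
Proof. by move=> x; rewrite smulmA. Qed.

Lemma smulm_exp_le m n k G (S : submodClosed G) : (n <= k)%N ->
  {subset smulm (ideal_exp m k) S <= smulm (ideal_exp m n) S}.
Proof.
move=> /subnK <-; elim: (k - n)%N => // j IHj x; rewrite addSn.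
by rewrite ideal_expS_smulm => /smulm_sub/IHj.
Qed.

(** The ideal generated by [m] and [r] is the unit ideal. *)
Lemma maximal_unit m r : maximal_ideal m -> (r : R^o) \notin m ->
  exists s : R, (1 - s * r : R^o) \in m.
Proof.
move=> [m1 m_max] rm.
have hJ : submod_prop (fun x : R^o => exists s : R, (x - s * r : R^o) \in m).
  split=> [|x y [s sx] [t ty]|a x [s sx]].
  - by exists 0; rewrite mul0r subr0 rpred0.
  - by exists (s + t); rewrite mulrDl opprD addrACA rpredD.
  - by exists (a * s); rewrite -mulrA -[a *: x]/(a * x) -mulrBr; exact: rpredZ.
have [/submod_ofP//|J1] := boolP ((1 : R^o) \in submod_of hJ).
case/negP: rm; rewrite -(m_max _ J1).
  by apply/submod_ofP; exists 1; rewrite mul1r subrr rpred0.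
by move=> x xm; apply/submod_ofP; exists 0; rewrite mul0r subr0.
Qed.

(** The images of K and W in the vector space G/mG are complementary. Zorn's
lemma gives W as a maximal submodule that contains mG and meets K in mG only.
*)
Lemma residue_complement m G (K : submodClosed G) : maximal_ideal m ->
  exists W : submodClosed G,
    (forall x, x \in W -> x \in K -> x \in smulm m (fullm G)) /\
    forall x, exists2 k, k \in K & x - k \in W.
Proof.
move=> m_max; pose mG := smulm m (fullm G).
pose P (W : submodClosed G) := {subset mG <= W} /\
  forall x, x \in W -> x \in K -> x \in mG.
have P0 : P mG by split=> x.
pose le (U V : {W | P W}) := `[< {subset sval U <= sval V} >].
have [|||W0 W_max] := @ZL_preorder {W | P W} (exist _ mG P0) le.
- by move=> U; exact/asboolP.
- by move=> U V Z /asboolP VU /asboolP UZ; apply/asboolP => x /VU/UZ.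
- move=> A A_tot; have [[U0 AU0]|A0] := pselect (exists U, A U); last first.
    by exists (exist _ mG P0) => U AU; case: A0; exists U.
  have hU : submod_prop (fun x => exists2 U, A U & x \in sval U).
    split=> [|x y [U AU xU] [V AV yV]|a x [U AU xU]].
    - by exists U0 => //; rewrite rpred0.
    - have [/asboolP UV|/asboolP VU] := A_tot _ _ AU AV.
        by exists V => //; apply: rpredD => //; exact: UV.
      by exists U => //; apply: rpredD => //; exact: VU.
    - by exists U => //; rewrite rpredZ.
  have PU : P (submod_of hU).
    split=> [x xm|x /submod_ofP[U _ xU] xK].
      by apply/submod_ofP; exists U0 => //; exact: (proj1 (svalP U0)).
    exact: (proj2 (svalP U)).
  exists (exist _ _ PU) => U AU; apply/asboolP => x xU.
  by apply/submod_ofP; exists U.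
have [mW WK] := svalP W0; set W := sval W0 in mW WK.
exists W; split=> // x.
apply: contrapT => noK.
have hV : submod_prop (fun y => exists r : R, y - r *: x \in W).
  split=> [|y z [r yr] [s zs]|a y [r yr]].
  - by exists 0; rewrite scale0r subr0 rpred0.
  - by exists (r + s); rewrite scalerDl opprD addrACA rpredD.
  - by exists (a * r); rewrite -scalerA -scalerBr rpredZ.
have WV : {subset W <= submod_of hV}.
  by move=> y yW; apply/submod_ofP; exists 0; rewrite scale0r subr0.
(* W + Rx still meets K in mG: for y = w + r x in K, either r is in m and y
   is in W, or r is invertible modulo m and x is in W + K. *)
have PV : P (submod_of hV).
  split=> [y /mW/WV//|y /submod_ofP[r yr] yK].
  have [rm|rm] := boolP ((r : R^o) \in m).
    apply: WK => //; rewrite -[y](subrK (r *: x)) rpredD// mW//.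
    by apply: spanm_sub; exists r, x; rewrite fullmP.
  have [s sr] := maximal_unit m_max rm; case: noK.
  exists (s *: y); first exact: rpredZ.
  have -> : x - s *: y = (1 - s * r) *: x - s *: (y - r *: x).
    by rewrite scalerBl scale1r scalerBr scalerA opprB addrA subrK.
  apply: submodB; last exact: rpredZ.
  by apply: mW; apply: spanm_sub; exists (1 - s * r), x; rewrite fullmP.
have /asboolP VW := W_max (exist _ _ PV) (asboolT WV).
case: noK; exists 0; first exact: rpred0.
rewrite subr0; apply: VW; apply/submod_ofP; exists 1.
by rewrite scale1r subrr rpred0.
Qed.

(** Projecting along the complement of K modulo mF gives q : F -> K such that c
= 1 - q maps K into mK, hence c^n maps K into m^n K. Take psi_n = 1 - c^n,
which is the sum of the c^j q for j < n: its values lie in K, it is the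
identity of K up to c^n, and its increments c^n q take their values in m^n K.
*)
Lemma approximate_retractions (E : choiceType) m
    (K : submodClosed {freeg E / R}) :
  maximal_ideal m ->
  (forall x, x \in K -> x \in smulm m (fullm {freeg E / R}) ->
     x \in smulm m K) ->
  exists psi : nat -> {linear {freeg E / R} -> {freeg E / R}},
    [/\ forall n x, psi n x \in K,
        forall n x, x \in K -> x - psi n x \in smulm (ideal_exp m n) K &
        forall n j x, psi (n + j)%N x - psi n x \in smulm (ideal_exp m n) K].
Proof.
move=> m_max K_pure; pose F : lmodType R := {freeg E / R}.
have [W [WK Wcov]] := residue_complement K m_max.
have /choice[k kP] : forall b : E, exists k,
    k \in K /\ (<< b >> : F) - k \in W.
  by move=> b; have [k kK kW] := Wcov << b >>; exists k.
pose q : {linear F -> F} := freem_lift k.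
have qK x : q x \in K.
  by apply: freeg_image_sub => b; rewrite [q _]freem_liftU; case: (kP b).
pose c : {linear F -> F} := idfun \- q.
have cW x : c x \in W.
  apply: freeg_image_sub => b.
  rewrite -[c _]/(<< b >> - q << b >>) [q _]freem_liftU.
  by case: (kP b).
have cK x : x \in K -> c x \in smulm m K.
  move=> xK; have cxK : c x \in K by exact: submodB.
  by apply: K_pure => //; apply: WK.
pose cn := fix cn n : {linear F -> F} :=
  if n is n'.+1 then cn n' \o c else idfun.
have cnK n x : x \in K -> cn n x \in smulm (ideal_exp m n) K.
  elim: n x => [|n IHn] x xK; first exact: smulm_full.
  rewrite ideal_expS_smulm -[cn _ _]/(cn n (c x)).
  exact: smulm_image IHn (cK x xK).
pose psi n : {linear F -> F} := idfun \- cn n.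
have psiE n x : psi n x = x - cn n x by [].
have psiS n x : psi n.+1 x = psi n x + cn n (q x).
  by rewrite !psiE -[cn n.+1 x]/(cn n (x - q x)) linearB opprB addrA addrAC.
exists psi; split=> [n x|n x xK|n j x].
- elim: n => [|n IHn]; first by rewrite psiE subrr rpred0.
  by rewrite psiS rpredD//; exact: smulm_sub (cnK n _ (qK x)).
- by rewrite psiE opprB addrC subrK; exact: cnK.
elim: j => [|j IHj]; first by rewrite addn0 subrr rpred0.
rewrite addnS psiS addrAC rpredD//.
by apply: smulm_exp_le (cnK (n + j)%N _ (qK x)); exact: leq_addr.
Qed.

End Products.

(** * Closed submodules of pure-injective modules are cotorsion *)

Section Closed.
Context {R : comNzRingType}.
Implicit Types (C N : lmodType R) (m : submodClosed R^o).

Definition adic_closed m N (T : submodClosed N) : Prop :=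
  forall x, (forall n, exists2 t, t \in T & x - t \in powm m n N) -> x \in T.

(** The unknown is th : F -> N. Exact equations require th = ka on K;
congruences require th = ka psi_n modulo m^n N on the basis, and put the values
of th in the closed submodule T. For finitely many conditions, with exponents
at most n0, th = ka (psi_n0 + (1 - psi_n0) ph) is a solution if ph fixes the
elements of K that occur. *)
Lemma flat_extension (E : choiceType) m C N (e : {linear {freeg E / R} -> C})
    (T : submodClosed N) (ka : {linear subm (submod_of (kerm_prop e)) -> N}) :
  noetherian R -> maximal_ideal m -> flat C -> surjm e ->
  pure_injective N -> adic_closed m T -> (forall k, ka k \in T) ->
  exists th : {linear {freeg E / R} -> N},
    (forall x, th x \in T) /\ forall k, th (\val k) = ka k.
Proof.
move=> R_noetherian m_max C_flat e_surj N_pi T_closed kaT.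
pose F : lmodType R := {freeg E / R}.
set K := submod_of _ in ka kaT *.
have fixK (s : seq F) : {subset s <= K} -> exists ph : {linear F -> F},
    (forall x, ph x \in K) /\ forall k, k \in s -> ph k = k.
  move=> sK; have [|ph [phK ph_id]] := flat_fix C_flat e_surj (s := s).
    by move=> k /sK/submod_ofP.
  by exists ph; split=> // x; apply/submod_ofP.
have K_pure x : x \in K -> x \in smulm m (fullm F) -> x \in smulm m K.
  move=> xK xm; have [|ph [phK ph_id]] := fixK [:: x].
    by move=> y; rewrite inE => /eqP->.
  rewrite -(ph_id x) ?mem_head//.
  by apply: (smulm_image (f := ph) _ xm) => y _; exact: phK.
have [psi [psiK psi_id psi_cauchy]] := approximate_retractions m_max K_pure.
have /choice[ps psE] : forall n, exists p : {linear F -> subm K},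
    forall x, \val (p x) = psi n x.
  by move=> n; exact: corestrict (psiK n).
have ka_small n k : \val k \in smulm (ideal_exp m n) K -> ka k \in powm m n N.
  move=> /smulm_subm kn; apply: (smulm_image (f := ka) _ kn) => y _.
  exact: fullmP.
pose I : choiceType := (subm K + E * nat)%type.
pose f (i : I) : F := match i with inl k => \val k | inr (b, n) => << b >> end.
pose a (i : I) : N :=
  match i with inl k => ka k | inr (b, n) => ka (ps n << b >>) end.
pose J (i : I) :=
  match i with inl _ => zero_ideal | inr (_, n) => ideal_exp m n end.
have [s|th thP] := pure_injective_congruences (f := f) (a := a) (J := J)
  R_noetherian N_pi.
  have [n0 n0P] := seq_bound (fun i : I => if i is inr (_, n) then n else 0) s.
  have [|ph [phK ph_id]] := fixK [seq f i | i : I <- s & is_inl i].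
    move=> x /mapP[[k|[b n]]]; rewrite mem_filter// => _ ->.
    exact: valP k.
  have [p pE] := corestrict phK.
  (* This is ka (psi_n0 + (1 - psi_n0) ph). *)
  pose th : {linear F -> N} := ka \o (ps n0 \+ (p \- (ps n0 \o ph))).
  have thE x : th x = ka (ps n0 x + (p x - ps n0 (ph x))) by [].
  exists th => -[k|[b n]] si; rewrite thE -linearB; last first.
    rewrite addrAC; apply: ka_small.
    rewrite val_submD !val_submB !psE pE rpredD//.
      by rewrite -(subnKC (n0P _ si)); exact: psi_cauchy.
    by apply: smulm_exp_le (psi_id n0 _ (phK _)); exact: n0P si.
  suff -> : ps n0 (val k) + (p (val k) - ps n0 (ph (val k))) - k = 0.
    by rewrite linear0 rpred0.
  apply: val_inj; rewrite val_submB val_submD val_submB !psE pE ph_id.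
    by rewrite addrCA subrr addr0 subrr.
  by apply/mapP; exists (inl k) => //; rewrite mem_filter si.
exists th; split=> [x|k].
  apply: freeg_image_sub => b; apply: T_closed => n.
  by exists (ka (ps n << b >>)) => //; exact: (thP (inr (b, n))).
by apply/eqP; rewrite -subr_eq0; apply/eqP/smulm_zero/(thP (inl k)).
Qed.

(** A cocycle f on P1 is a map on the kernel of P0 -> C. As [flat_extension] is
about free modules, it is pulled back to a free cover of P0, extended there,
and restricted along a splitting of the cover. *)
Lemma closed_cotorsion m N (T : submodClosed N) :
  noetherian R -> maximal_ideal m -> pure_injective N -> adic_closed m T ->
  cotorsion (subm T).
Proof.
move=> R_noetherian m_max N_pi T_closed C C_flat P2 P1 P0 d2 d1 e.
move=> [[_ _ P0_proj] [ex2 ex1 e_surj]] f fd2.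
have f_wd u v : d1 u = d1 v -> f u = f v.
  move=> /eqP; rewrite -subr_eq0 -linearB => /eqP/ex2[w uv].
  by apply/eqP; rewrite -subr_eq0 -linearB -uv fd2.
pose p := free_cover P0.
have [s ps] := P0_proj _ _ p (idfun : {linear P0 -> P0}) (@free_cover_surj _ _).
pose e' : {linear {freeg P0 / R} -> C} := e \o p.
have e'_surj : surjm e'.
  move=> c; have [x <-] := e_surj c; exists (s x).
  by rewrite -[LHS]/(e (p (s x))) ps.
pose K := submod_of (kerm_prop e').
have /choice[y yP] : forall k : subm K, exists y, d1 y = p (\val k).
  by move=> k; apply/ex1; have /submod_ofP := valP k.
have ka_lin : linear (fun k => \val (f (y k))).
  move=> c k l; rewrite -linearP -linearP; congr (val _); apply: f_wd.
  by rewrite linearP !yP !linearP.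
have kaT k : linear_of ka_lin k \in T by exact: valP (f (y k)).
have [th [thT thE]] := flat_extension R_noetherian m_max C_flat e'_surj N_pi
  T_closed kaT.
have [g gE] := corestrict thT.
exists (g \o s) => x; apply: val_inj.
have sK : s (d1 x) \in K.
  apply/submod_ofP; rewrite -[LHS]/(e (p (s (d1 x)))) ps.
  by apply/ex1; exists x.
rewrite -[RHS]/(val (g (s (d1 x)))) gE.
rewrite -[s (d1 x)]/(val (exist _ (s (d1 x)) sK : subm K)) thE.
rewrite -[RHS]/(val (f (y _))); congr (val _); apply: f_wd.
by rewrite yP -[RHS]/(p (s (d1 x))) ps.
Qed.

End Closed.

(** * The adic closure of a pure submodule *)

Section Closure.
Context {R : comNzRingType}.
Implicit Types (N : lmodType R) (m J : submodClosed R^o).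

(** Purity for the module X = R/J: the element 1 (x) x vanishes in X (x) N,
hence in X (x) M, which maps to M/JM. *)
Lemma pure_smulm J N (M : submodClosed N) x : pure M -> x \in M ->
  x \in smulm J (fullm N) -> x \in smulm J M.
Proof.
move=> M_pure xM xJ; pose u : subm M := exist _ x xM.
pose X : lmodType R := quotm J.
have t_lin : linear (tensor (quotm_proj J 1) : N -> tens X N).
  by move=> c y z; rewrite tensorDr tensorZr.
have u0 : tensor (quotm_proj J 1) u = 0 :> tens X (subm M).
  apply: (M_pure X); rewrite linear0 tens_mapE.
  apply/(submod_ofP (kerm_prop (linear_of t_lin))).
  apply: (spanm_min _ xJ) => _ [a [y [aJ _ ->]]]; apply/submod_ofP.
  have a1 : a *: quotm_proj J 1 = 0.
    apply/eqP; rewrite -linearZ_LR quotm_projP.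
    suff -> : a *: (1 : R^o) = a by [].
    exact: mulr1.
  rewrite -[LHS]/(tensor _ _) tensorZr -tensorZl a1.
  by rewrite -[0](scale0r 0) tensorZl scale0r.
pose JM := smulm J (fullm (subm M)).
have f_bil : bilinear_op (fun (r : X) (v : subm M) =>
    quotm_proj JM ((quotm_repr r : R) *: v)).
  split=> [v|r] c y z /=; last first.
    by rewrite -linearP scalerDr !scalerA mulrC.
  rewrite -linearP; apply/quotm_proj_eq.
  rewrite scalerA -scalerDl -scalerBl; apply: spanm_sub.
  exists (quotm_repr (c *: y + z) - (c * quotm_repr y + quotm_repr z)), v.
  split; rewrite ?fullmP//.
  apply/quotm_proj_eq; rewrite quotm_reprK.
  by rewrite (quotm_proj_linear J c) !quotm_reprK.
have [h hP] := tens_lift f_bil.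
have : h (tensor (quotm_proj J 1) u) = 0 by rewrite u0 linear0.
rewrite hP => /eqP; rewrite quotm_projP => /smulm_subm.
have rJ := quotm_repr_proj J 1; set r := quotm_repr _ in rJ * => ru.
have -> : x = (r : R) *: x - (r - 1) *: x by rewrite -scalerBl subKr scale1r.
apply: submodB; first exact: ru.
by apply: spanm_sub; exists (r - 1), x.
Qed.

Lemma closm_prop m N (M : submodClosed N) :
  submod_prop (fun x => forall n, exists2 t, t \in M & x - t \in powm m n N).
Proof.
split=> [n|x y hx hy n|a x hx n].
- by exists 0; rewrite ?subr0 rpred0.
- have [[s sM xs] [t tM yt]] := (hx n, hy n).
  by exists (s + t); rewrite ?opprD 1?addrACA rpredD.
- have [s sM xs] := hx n.
  by exists (a *: s); rewrite -?scalerBr rpredZ.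
Qed.

Definition closm m N (M : submodClosed N) : submodClosed N :=
  submod_of (closm_prop m M).

Lemma closm_closed m N (M : submodClosed N) : adic_closed m (closm m M).
Proof.
move=> x hx; apply/submod_ofP => n.
have [t /submod_ofP/(_ n)[s sM ts] xt] := hx n; exists s => //.
by rewrite -(subrKA t) rpredD.
Qed.

Lemma partial_sums_cauchy m N (S : submodClosed N) (d : nat -> N) n k :
  (forall j, d j \in smulm (ideal_exp m j) S) -> (n <= k)%N ->
  \sum_(j < k) d j - \sum_(j < n) d j \in smulm (ideal_exp m n) S.
Proof.
move=> dS /subnKC <-; elim: (k - n)%N => [|j IHj].
  by rewrite addn0 subrr rpred0.
rewrite addnS big_ord_recr addrAC rpredD//.
by apply: smulm_exp_le (dS _); exact: leq_addr.
Qed.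

Lemma pure_injective_limit m N (d : nat -> N) :
  noetherian R -> pure_injective N -> (forall j, d j \in powm m j N) ->
  exists x, forall n, x - \sum_(j < n) d j \in powm m n N.
Proof.
move=> R_noetherian N_pi dN.
have [s|th thP] := pure_injective_congruences (f := fun=> (1 : R^o))
    (a := fun n => \sum_(j < n) d j) (J := ideal_exp m) R_noetherian N_pi.
  have [n0 n0P] := seq_bound id s.
  have th_lin : linear (fun r : R^o => (r : R) *: \sum_(j < n0) d j).
    by move=> c u v; rewrite scalerDl scalerA.
  exists (linear_of th_lin) => n /n0P ns.
  rewrite -[linear_of _ _]/(1 *: \sum_(j < n0) d j) scale1r.
  exact: partial_sums_cauchy.
by exists (th 1).
Qed.

(** This makes T/M radical-full, where T is the closure of M. If x is the limit
of a_n with a_(n+1) - a_n = sum_i s_i d_(n,i) and d_(n,i) in m^n M, the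
unknowns y_i are subject to sum_i s_i y_i = x - a_0 and to y_i = d_(0,i) + ...
+ d_(n-1,i) modulo m^n N for all n; the congruences put the y_i in T. The last
partial sums, corrected by the decomposition of x - a_n over the s_i, solve any
finite part. *)
Lemma closm_decomposition m N (M : submodClosed N) x :
  noetherian R -> pure_injective N -> pure M -> x \in closm m M ->
  exists2 a, a \in M & x - a \in smulm m (closm m M).
Proof.
move=> R_noetherian N_pi M_pure /submod_ofP xM.
have [s sm] := noetherian_fg R_noetherian m.
have /choice[a aP] : forall n, exists a, a \in M /\ x - a \in powm m n.+1 N.
  by move=> n; have [a aM xa] := xM n.+1; exists a.
have /choice[d dP] : forall n, exists d : nat -> N,
    (forall i, d i \in smulm (ideal_exp m n) M) /\
    a n.+1 - a n = \sum_(i < size s) (s`_i : R) *: d i.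
  move=> n; apply/(smulmP _ _ sm); rewrite -ideal_expS_smulm.
  apply: pure_smulm => //.
    by apply: submodB; [case: (aP n.+1) | case: (aP n)].
  have -> : a n.+1 - a n = (x - a n) - (x - a n.+1).
    by rewrite opprB [RHS]addrC subrKA.
  apply: submodB; first by case: (aP n).
  by apply: powmS; case: (aP n.+1).
pose b n i := \sum_(j < n) d j i.
have bM n i : b n i \in M.
  by apply: rpred_sum => j _; case: (dP j) => dM _; exact: smulm_sub (dM i).
have aE n : a n - a 0 = \sum_(i < size s) (s`_i : R) *: b n i.
  elim: n => [|n IHn].
    by rewrite subrr big1// => i _; rewrite /b big_ord0 scaler0.
  rewrite -(subrKA (a n)) IHn (proj2 (dP n)) -big_split; apply: eq_bigr => i _.
  by rewrite /= -scalerDr /b big_ord_recr addrC.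
have b_cauchy n k i : (n <= k)%N -> b k i - b n i \in powm m n N.
  move=> nk; apply: (partial_sums_cauchy (d := fun j => d j i)) => // j.
  by apply: (smulmS _ _ (proj1 (dP j) i)) => // y _; exact: fullmP.
pose F : lmodType R := {freeg nat / R}.
pose f (c : option (nat * nat)) : F :=
  if c is Some (i, _) then << i >>
  else \sum_(i < size s) (s`_i : R) *: << i : nat >>.
pose v (c : option (nat * nat)) : N :=
  if c is Some (i, n) then b n i else x - a 0.
pose J (c : option (nat * nat)) :=
  if c is Some (_, n) then ideal_exp m n else zero_ideal.
have [t|th thP] := pure_injective_congruences (f := f) (a := v) (J := J)
    R_noetherian N_pi.
  have [n0 n0P] := seq_bound
    (fun c : option (nat * nat) => if c is Some (_, n) then n else 0) t.
  have [y [yN xyE]] : exists y : nat -> N, (forall i, y i \in powm m n0 N) /\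
      x - a n0 = \sum_(i < size s) (s`_i : R) *: y i.
    by apply/(smulmP _ _ sm); rewrite -ideal_expS_smulm; case: (aP n0).
  pose th : {linear F -> N} := freem_lift (fun i => b n0 i + y i).
  exists th => -[[i n]|] /n0P ct.
    rewrite [th _]freem_liftU addrAC rpredD//; first exact: b_cauchy.
    exact: smulm_exp_le (yN i).
  suff -> : th (f None) = v None by rewrite subrr rpred0.
  rewrite linear_sum -[RHS](subrKA (a n0)) xyE aE -big_split.
  apply: eq_bigr => i _.
  by rewrite linearZ_LR [th _]freem_liftU scalerDr addrC.
exists (a 0); first by case: (aP 0).
have <- : th (f None) = x - a 0.
  by apply/eqP; rewrite -subr_eq0; apply/eqP/smulm_zero/(thP None).
rewrite linear_sum; apply: rpred_sum => i _; rewrite linearZ_LR.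
apply: spanm_sub; exists (s`_i), (th << i : nat >>); split=> //.
  by case: sm => sm _; rewrite sm ?mem_nth.
by apply/submod_ofP => n; exists (b n i) => //;
  exact: (thP (Some (i : nat, n))).
Qed.

Lemma smulm_imagem J N N' (f : {linear N -> N'}) (S : submodClosed N) :
  {subset smulm J (imagem f S) <= imagem f (smulm J S)}.
Proof.
apply: spanm_min => _ [a [_ [aJ /submod_ofP[x xS ->] ->]]].
apply/submod_ofP; exists (a *: x); last by rewrite linearZ_LR.
by apply: spanm_sub; exists a, x.
Qed.

End Closure.

(** * The completion *)

Section Completion.
Context {R : comNzRingType}.

(** An element of the completion is a coherent family of classes in M/m^n M,
and is sent to the limit in N1 of any family of representatives. The limit is
unique up to H(N1); it lies in H(N1) only for the zero family because m^n N1
meets M in m^n M, and every element of N1 is a limit because N1 = M + m^n N1.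
*)
Lemma completion_iso (m : submodClosed R^o) (N : lmodType R)
    (M N1 : submodClosed N) :
  {subset M <= N1} ->
  (forall n x, x \in M -> x \in smulm (ideal_exp m n) N1 ->
     x \in smulm (ideal_exp m n) M) ->
  (forall n x, x \in N1 -> exists2 a, a \in M &
     x - a \in smulm (ideal_exp m n) N1) ->
  (forall a : nat -> N, (forall n, a n \in M) ->
     (forall n, a n.+1 - a n \in smulm (ideal_exp m n) M) ->
     exists2 t, t \in N1 & forall n, t - a n \in smulm (ideal_exp m n) N1) ->
  exists f : {linear completion m (subm M) -> quotm (hsubm m (subm N1))},
    bijective f.
Proof.
move=> MN1 M_pure M_dense M_lim.
pose MM : lmodType R := subm M.
pose NN : lmodType R := subm N1.
have powM n (u : MM) : u \in powm m n MM <-> \val u \in smulm (ideal_exp m n) M.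
  exact: smulm_subm.
have MN n : {subset smulm (ideal_exp m n) M <= smulm (ideal_exp m n) N1}.
  exact: smulmS.
pose lim (x : completion m MM) (t : NN) := forall n (u : MM),
  quotm_proj (powm m n MM) u = (\val x) n ->
  \val t - \val u \in smulm (ideal_exp m n) N1.
have limP x t (a : nat -> MM) :
    (forall n, quotm_proj (powm m n MM) (a n) = (\val x) n) ->
    (forall n, \val t - \val (a n) \in smulm (ideal_exp m n) N1) -> lim x t.
  move=> ax ta n u ux.
  have -> : \val t - \val u = (\val t - \val (a n)) + (\val (a n) - \val u).
    by rewrite subrKA.
  apply: rpredD; first exact: ta.
  by apply/MN/(powM n (a n - u))/quotm_proj_eq; rewrite ax.
have lim_ex x : exists t, lim x t.
  pose a n : MM := quotm_repr ((\val x) n).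
  have ax n : quotm_proj (powm m n MM) (a n) = (\val x) n by exact: quotm_reprK.
  have [|n|t tN1 ta] := M_lim (fun n => \val (a n)).
  - by move=> n; exact: valP (a n).
  - apply/(powM n (a n.+1 - a n))/quotm_proj_eq; rewrite ax.
    have /submod_ofP/(_ n) <- := valP x.
    by rewrite -ax; apply/esym/(quotm_lift_proj (@transm_subproof _ m MM n)).
  by exists (exist _ t tN1); apply: (limP _ _ a).
have lim_linear c x y s t : lim x s -> lim y t -> lim (c *: x + y) (c *: s + t).
  move=> xs yt.
  pose a n : MM := quotm_repr ((\val x) n).
  pose b n : MM := quotm_repr ((\val y) n).
  apply: (limP _ _ (fun n => c *: a n + b n)) => n.
    by rewrite quotm_proj_linear !quotm_reprK.
  have -> : \val (c *: s + t) - \val (c *: a n + b n) =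
      c *: (\val s - \val (a n)) + (\val t - \val (b n)).
    by rewrite scalerBr addrACA -opprD.
  apply: rpredD; last by apply: yt; exact: quotm_reprK.
  by apply: rpredZ; apply: xs; exact: quotm_reprK.
have lim_unique x s t : lim x s -> lim x t -> s - t \in hsubm m NN.
  move=> xs xt; apply/submod_ofP => n _; apply/smulm_subm.
  pose u : MM := quotm_repr ((\val x) n).
  have -> : \val (s - t) = (\val s - \val u) - (\val t - \val u).
    by rewrite opprB subrKA.
  by apply: submodB; [apply: xs | apply: xt]; exact: quotm_reprK.
have lim_null x t : lim x t -> t \in hsubm m NN -> x = 0.
  move=> xt tH; apply: val_inj; apply: functional_extensionality_dep => n.
  pose u : MM := quotm_repr ((\val x) n).
  have ux : quotm_proj (powm m n MM) u = (\val x) n by exact: quotm_reprK.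
  rewrite -ux; apply/eqP; rewrite quotm_projP; apply/powM.
  apply: M_pure; first exact: valP u.
  have -> : \val u = \val t - (\val t - \val u) by rewrite subKr.
  apply: submodB; last exact: xt.
  case: n {u ux} => [|n]; first exact/smulm_full/(valP t).
  by have /submod_ofP/(_ n.+1 isT)/smulm_subm := tH.
have /choice[t tP] := lim_ex.
have f_lin : linear (fun x => quotm_proj (hsubm m NN) (t x)).
  move=> c x y; rewrite -quotm_proj_linear; apply/quotm_proj_eq.
  by apply: lim_unique (tP _) _; apply: lim_linear; exact: tP.
pose f := linear_of f_lin; exists f.
have f_inj : injective f.
  move=> x y xy; apply/eqP; rewrite -subr_eq0; apply/eqP.
  apply: (lim_null _ (t (x - y))) => //.
  by rewrite -quotm_projP -[quotm_proj _ _]/(f (x - y)) linearB xy subrr.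
have f_surj : surjm f.
  move=> z; rewrite -[z]quotm_reprK; set s := quotm_repr z.
  have /choice[a aP] : forall n, exists a : MM,
      \val s - \val a \in smulm (ideal_exp m n) N1.
    by move=> n; have [a aM sa] := M_dense n _ (valP s); exists (exist _ a aM).
  pose x0 : prodm (fun n => quotm (powm m n MM)) :=
    fun n => quotm_proj (powm m n MM) (a n).
  have x0P : x0 \in submod_of (coherent_prop m MM).
    apply/submod_ofP => n.
    rewrite [LHS](quotm_lift_proj (@transm_subproof _ m MM n)).
    apply/quotm_proj_eq/powM/M_pure; first exact: valP (a n.+1 - a n).
    have -> : \val (a n.+1 - a n) =
        (\val s - \val (a n)) - (\val s - \val (a n.+1)).
      by rewrite opprB [RHS]addrC subrKA.
    apply: submodB; first exact: aP.
    by apply: smulm_exp_le (aP n.+1); exact: leqnSn.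
  exists (exist _ x0 x0P); apply/quotm_proj_eq.
  by apply: lim_unique (tP _) _; apply: (limP _ _ a).
have [g [fK gK]] := linear_bij_inv f_inj f_surj.
by exists g.
Qed.

End Completion.

Theorem mainTheorem7 (R : comNzRingType) (m : submodClosed R^o)
    (R_noetherian : noetherian R) (R_local : local_ring m)
    (N : lmodType R) (M N1 : submodClosed N)
    (M_separated : separated m (subm M))
    (MN_hull : pure_injective_hull M)
    (M_sub_N1 : {subset M <= N1})
    (N1_def : imagem (quotm_proj M) N1 =i psubm m (quotm M)) :
  cotorsion (subm N1) /\
  exists f : {linear completion m (subm M) -> quotm (hsubm m (subm N1))},
    bijective f.
Proof.
have [[M_pure _] N_pi] := MN_hull; have [m_max _] := R_local.
pose p : {linear N -> quotm M} := quotm_proj M.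
have N1_dense n x : x \in N1 ->
    exists2 a, a \in M & x - a \in smulm (ideal_exp m n) N1.
  move=> xN1.
  have : p x \in smulm (ideal_exp m n) (imagem p N1).
    have : p x \in imagem p N1 by apply/submod_ofP; exists x.
    elim: n (p x) => [|n IHn] y yN1; first exact: smulm_full.
    rewrite ideal_expS_smulm.
    have : y \in smulm m (psubm m (quotm M)).
      have /radical_full_subm := @psubm_radical_full R m (quotm M).
      by apply; rewrite -N1_def.
    apply: smulmS => // z zP; apply: IHn; by rewrite N1_def.
  move=> /smulm_imagem/submod_ofP[y yN1 /quotm_proj_eq xy].
  by exists (x - y); rewrite ?subKr.
have small n : {subset smulm (ideal_exp m n) N1 <= powm m n N}.
  by apply: smulmS => // x _; exact: fullmP.
have N1E : N1 =i closm m M.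
  move=> x; apply/idP/idP => [xN1|xcl].
    apply/submod_ofP => n; have [a aM xa] := N1_dense n x xN1.
    by exists a => //; exact: small xa.
  have T_full : radical_full m (subm (imagem p (closm m M))).
    apply/radical_full_subm => _ /submod_ofP[y ycl ->].
    have [a aM ya] := closm_decomposition R_noetherian N_pi M_pure ycl.
    have -> : p y = p (y - a) by apply/quotm_proj_eq; rewrite subKr.
    by apply: smulm_image ya => z zcl; apply/submod_ofP; exists z.
  have : p x \in psubm m (quotm M).
    by apply: (psubm_max T_full); apply/submod_ofP; exists x.
  rewrite -N1_def => /submod_ofP[y yN1 /quotm_proj_eq/M_sub_N1 xy].
  by rewrite -(subrK y x) rpredD.
have N1_closed : adic_closed m N1.
  move=> x hx; rewrite N1E; apply: closm_closed => n.
  by have [t tN1 xt] := hx n; exists t; rewrite -?N1E.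
split; first exact: closed_cotorsion R_noetherian m_max N_pi N1_closed.
apply: completion_iso => // [n x xM /small xN|a aM a_cauchy].
  exact: pure_smulm.
have a_sum n : a n = a 0 + \sum_(j < n) (a j.+1 - a j).
  elim: n => [|n IHn]; first by rewrite big_ord0 addr0.
  by rewrite big_ord_recr /= addrA -IHn addrC subrK.
have [|t0 t0P] := pure_injective_limit (m := m) (d := fun j => a j.+1 - a j)
    R_noetherian N_pi.
  by move=> j; apply: (smulmS _ _ (a_cauchy j)) => // y _; exact: fullmP.
pose t := a 0 + t0.
have ta n : t - a n \in powm m n N by rewrite a_sum opprD addrACA subrr add0r.
have tN1 : t \in N1 by rewrite N1E; apply/submod_ofP => n; exists (a n).
exists t => // n; have [b bM tb] := N1_dense n t tN1.
have -> : t - a n = (t - b) + (b - a n) by rewrite subrKA.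
have MN1 : {subset smulm (ideal_exp m n) M <= smulm (ideal_exp m n) N1}.
  exact: smulmS.
rewrite rpredD// MN1//; apply: pure_smulm => //; first exact: submodB.
have -> : b - a n = (t - a n) - (t - b) by rewrite opprB [RHS]addrC subrKA.
by apply: submodB => //; exact: small.
Qed.
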